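(* Let $\eta$ be any positive equivalence relation. Then: (a) there are explanatorily learnable $\eta$-families $\mathcal L_1,\mathcal L_2$ with no common member such that $\mathcal L_1\cup\mathcal L_2$ is an $\eta$-family that is not explanatorily learnable; likewise there are vacillatorily learnable $\eta$-families $\mathcal L_1,\mathcal L_2$ with no common member such that $\mathcal L_1\cup\mathcal L_2$ is an $\eta$-family that is not vacillatorily learnable; (b) behaviourally correct learning is closed under union with respect to $\eta$ if and only if $\mathbb N$ is the only $\eta$-infinite r.e. set.
   Context: A positive equivalence relation is an equivalence relation $\eta$ on $\mathbb{N}$ that is recursively enumerable (as a set of pairs) and has infinitely many equivalence classes. A set is $\eta$-closed if it is a union of $\eta$-classes and $\eta$-infinite if it is a union of infinitely many $\eta$-classes. An $\eta$-family is an infinite family of $\eta$-closed sets possessing a uniformly r.e. one-one numbering $B_0,B_1,\dots$ (i.e. $\{\langle k,x\rangle:x\in B_k\}$ is r.e. and $B_i\neq B_j$ for $i\ne j$). $W_0,W_1,\dots$ is a fixed acceptable numbering of the r.e. sets. A text for $L$ is a total $T:\mathbb N\to\mathbb N\cup\{\#\}$ whose range minus $\{\#\}$ is $L$; $T[n]$ is its initial segment of length $n$. A learner is a recursive function $M$ from finite sequences over $\mathbb N\cup\{\#\}$ to $\mathbb N\cup\{?\}$; an output $e$ is interpreted as the hypothesis ''the $\eta$-closure of $W_e$''. A family $\mathcal C$ is explanatorily learnable if some $M$, on every text $T$ for every $L\in\mathcal C$, outputs from some point on a single index whose hypothesis equals $L$; behaviourally correctly learnable if some $M$, on every such text, outputs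 for almost all $n$ an index whose hypothesis equals $L$; vacillatorily learnable if some $M$ behaviourally correctly learns $\mathcal C$ and on every text $T$ for every $L\in\mathcal C$ the set $\{M(T[n]):n\ge 1\}$ is finite. A learning criterion $I$ is closed under union with respect to $\eta$ if for all $I$-learnable $\eta$-families $\mathcal L,\mathcal H$ such that $\mathcal L\cup\mathcal H$ is an $\eta$-family, $\mathcal L\cup\mathcal H$ is $I$-learnable. *)

(* Defs.v *)
From Stdlib Require Export RelationClasses.
From Stdlib Require Cantor.
From mathcomp Require Export all_boot.
From mathcomp Require Export boolp classical_sets functions cardinality.

Set Implicit Arguments.
Unset Strict Implicit.
Unset Printing Implicit Defensive.

Local Open Scope classical_set_scope.

Definition npair (x y : nat) : nat := Cantor.to_nat (x, y).
Definition nfst (z : nat) : nat := (Cantor.of_nat z).1.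
Definition nsnd (z : nat) : nat := (Cantor.of_nat z).2.

(* The total recursive functions, as the least class of functions containing
   the initial functions and closed under composition, primitive recursion and
   minimization of regular functions (those for which the minimum always
   exists).  All functions are unary; further arguments are passed through the
   Cantor pairing, whose projections are therefore initial functions. *)
Inductive recursive : (nat -> nat) -> Prop :=
| recursive_zero : recursive (fun=> 0)
| recursive_succ : recursive succn
| recursive_fst : recursive nfst
| recursive_snd : recursive nsnd
| recursive_pair f g : recursive f -> recursive g ->
    recursive (fun x => npair (f x) (g x))
| recursive_comp f g : recursive f -> recursive g ->
    recursive (fun x => f (g x))
| recursive_prec f g : recursive f -> recursive g ->
    recursive (fun z =>
      iteri (nsnd z) (fun k r => g (npair (nfst z) (npair k r))) (f (nfst z)))
| recursive_mu f h : recursive f ->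
    (forall x, f (npair x (h x)) = 0) ->
    (forall x y, y < h x -> f (npair x y) <> 0) ->
    recursive h
| recursive_ext f g : recursive f -> f =1 g -> recursive g.

Definition re (A : set nat) : Prop :=
  A = set0 \/ exists2 f, recursive f & A = range f.

Definition uniformly_re (B : nat -> set nat) : Prop :=
  re [set z | B (nfst z) (nsnd z)].

(* Acceptable numberings of the r.e. sets: uniformly r.e., and every uniformly
   r.e. sequence translates effectively into it (constant sequences show that
   all r.e. sets occur). *)
Definition acceptable (W : nat -> set nat) : Prop :=
  uniformly_re W /\
  forall V, uniformly_re V -> exists2 f, recursive f & forall e, V e = W (f e).

Section Positive.
Variable eta : nat -> nat -> Prop.

(* [eta x], read as a set, is the class of x. *)
Definition eta_classes : set (set nat) := range eta.

Definition positive_equivalence : Prop :=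
  [/\ Equivalence eta, re [set z | eta (nfst z) (nsnd z)]
    & infinite_set eta_classes].

Definition eta_closed (A : set nat) : Prop :=
  exists2 X, X `<=` eta_classes & A = \bigcup_(C in X) C.

Definition eta_infinite (A : set nat) : Prop :=
  exists X, [/\ X `<=` eta_classes, infinite_set X & A = \bigcup_(C in X) C].

Definition eta_closure (A : set nat) : set nat :=
  [set y | exists2 x, A x & eta x y].

Definition eta_family (C : set (set nat)) : Prop :=
  [/\ infinite_set C, C `<=` eta_closed
    & exists B : nat -> set nat,
        [/\ uniformly_re B, injective B & C = range B]].

End Positive.

(* [None] is the pause symbol # in texts and the output ? of learners. *)
Definition text : Type := nat -> option nat.

Definition text_for (T : text) (L : set nat) : Prop :=
  L = [set x | exists n, T n = Some x].

Definition learner : Type := seq (option nat) -> option nat.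

Definition code_option (a : option nat) : nat := if a is Some x then x.+1 else 0.

Definition code_seq (s : seq (option nat)) : nat :=
  foldr (fun a c => (npair (code_option a) c).+1) 0 s.

Definition recursive_learner (M : learner) : Prop :=
  exists2 g, recursive g & forall s, g (code_seq s) = code_option (M s).

Section Learning.
Variables (W : nat -> set nat) (eta : nat -> nat -> Prop).

(* [mkseq T n] is the initial segment T[n]. *)
Definition ex_learns (M : learner) (C : set (set nat)) : Prop :=
  forall L T, C L -> text_for T L ->
    exists2 e, eta_closure eta (W e) = L &
      exists n0, forall n, n0 <= n -> M (mkseq T n) = Some e.

Definition bc_learns (M : learner) (C : set (set nat)) : Prop :=
  forall L T, C L -> text_for T L ->
    exists n0, forall n, n0 <= n ->
      exists2 e, M (mkseq T n) = Some e & eta_closure eta (W e) = L.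

Definition vac_learns (M : learner) (C : set (set nat)) : Prop :=
  bc_learns M C /\
  forall L T, C L -> text_for T L ->
    finite_set [set M (mkseq T n) | n in [set n | 1 <= n]].

Definition ex_learnable (C : set (set nat)) : Prop :=
  exists2 M, recursive_learner M & ex_learns M C.

Definition bc_learnable (C : set (set nat)) : Prop :=
  exists2 M, recursive_learner M & bc_learns M C.

Definition vac_learnable (C : set (set nat)) : Prop :=
  exists2 M, recursive_learner M & vac_learns M C.

End Learning.

Definition closed_under_union (eta : nat -> nat -> Prop)
    (I : set (set nat) -> Prop) : Prop :=
  forall L H : set (set nat),
    eta_family eta L -> eta_family eta H -> I L -> I H ->
    eta_family eta (L `|` H) -> I (L `|` H).

(* Main.v *)
Require Import Defs.

(* The number of classes among [f 0], ..., [f (y - 1)] can only be seen to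
   shrink, so for every recursive [f] meeting infinitely many classes the sets
   "first [k + 1] classes met by [f]" form a strictly increasing uniformly r.e.
   chain without repetitions, and this chain is explanatorily learnable: the
   least [e] such that [f e] is missing from the data determines the member.

   Suppose an r.e. eta-infinite set [A] omits [a], and let [f] enumerate [A].
   The chain of [A], and the family of [A] together with the members of the
   chain enlarged by the class of [a], are both explanatorily learnable; their
   union contains [A] and all the members of a chain exhausting [A], so a locking
   sequence for [A] shows that it is not even behaviourally correctly learnable.

   Suppose now that N is the only eta-infinite r.e. set.  A behaviourally
   correctly learnable family cannot contain N: by a telltale argument infinitely
   many of its members would omit a common point, and their union could be made
   an eta-infinite r.e. set.  Hence learnable families consist of finite unions of
   classes, which are learned by conjecturing the closure of the data.  For
   part (a), one family contains the class of [0], the other one the union of the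
   classes of [0] and [x] for almost all classes, and a vacillatory learner of
   both would make the complement of the class of [0] r.e. up to finitely many
   classes. *)

Local Open Scope classical_set_scope.

(** * Recursive functions and r.e. sets *)

Lemma nfstK x y : nfst (npair x y) = x.
Proof. by rewrite /nfst /npair Cantor.cancel_of_to. Qed.

Lemma nsndK x y : nsnd (npair x y) = y.
Proof. by rewrite /nsnd /npair Cantor.cancel_of_to. Qed.

Lemma npairK z : npair (nfst z) (nsnd z) = z.
Proof.
by rewrite /nfst /nsnd /npair -surjective_pairing Cantor.cancel_to_of.
Qed.

Lemma recursive_id : recursive (fun z => z).
Proof.
apply: (recursive_ext (recursive_pair recursive_fst recursive_snd)).
exact: npairK.
Qed.

Lemma recursive_const n : recursive (fun=> n).
Proof.
elim: n => [|n IH]; first exact: recursive_zero.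
exact: (recursive_comp recursive_succ IH).
Qed.

Lemma recursive_S f : recursive f -> recursive (fun z => (f z).+1).
Proof. exact: (recursive_comp recursive_succ). Qed.

Lemma recursive_nfst f : recursive f -> recursive (fun z => nfst (f z)).
Proof. exact: (recursive_comp recursive_fst). Qed.

Lemma recursive_nsnd f : recursive f -> recursive (fun z => nsnd (f z)).
Proof. exact: (recursive_comp recursive_snd). Qed.

Lemma recursive_iteri f n (G : nat -> nat -> nat -> nat) :
  recursive f -> recursive n ->
  recursive (fun w => G (nfst w) (nfst (nsnd w)) (nsnd (nsnd w))) ->
  recursive (fun z => iteri (n z) (fun k r => G z k r) (f z)).
Proof.
move=> rf rn rG.
have H := recursive_comp (recursive_prec rf rG) (recursive_pair recursive_id rn).
apply: (recursive_ext H) => z /=; rewrite nfstK nsndK.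
by apply: eq_iteri => k r; rewrite !(nfstK, nsndK).
Qed.

(** A primitive recursion of length [b z]: no step leaves [g z], one step replaces it by [f z]. *)
Lemma recursive_if (b : nat -> bool) f g :
  recursive (fun z => b z : nat) -> recursive f -> recursive g ->
  recursive (fun z => if b z then f z else g z).
Proof.
move=> rb rf rg.
have H := @recursive_iteri g (fun z => b z : nat) (fun z _ _ => f z) rg rb.
apply: recursive_ext (H _) _; first exact: (recursive_comp rf recursive_fst).
by move=> z; case: (b z).
Qed.

Lemma recursive_negb (b : nat -> bool) :
  recursive (fun z => b z : nat) -> recursive (fun z => ~~ b z : nat).
Proof.
move=> rb; apply: recursive_ext (recursive_if b _ _ rb (recursive_const 0) (recursive_const 1)) _.
by move=> z; case: (b z).
Qed.

Lemma recursive_andb (b c : nat -> bool) :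
  recursive (fun z => b z : nat) -> recursive (fun z => c z : nat) ->
  recursive (fun z => b z && c z : nat).
Proof.
move=> rb rc; apply: recursive_ext (recursive_if b _ _ rb rc (recursive_const 0)) _.
by move=> z; case: (b z).
Qed.

Lemma recursive_orb (b c : nat -> bool) :
  recursive (fun z => b z : nat) -> recursive (fun z => c z : nat) ->
  recursive (fun z => b z || c z : nat).
Proof.
move=> rb rc; apply: recursive_ext (recursive_if b _ _ rb (recursive_const 1) rc) _.
by move=> z; case: (b z).
Qed.

Lemma recursive_pred f : recursive f -> recursive (fun z => (f z).-1).
Proof.
move=> rf; have H := @recursive_iteri (fun=> 0) f (fun _ k _ => k) (recursive_const 0) rf.
apply: recursive_ext (H (recursive_nfst _ recursive_snd)) _.
by move=> z; case: (f z).
Qed.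

Lemma recursive_iter f n (G : nat -> nat -> nat) :
  recursive f -> recursive n ->
  recursive (fun w => G (nfst w) (nsnd w)) ->
  recursive (fun z => iter (n z) (fun r => G z r) (f z)).
Proof.
move=> rf rn rG.
have rG' : recursive (fun w => G (nfst w) (nsnd (nsnd w))).
  have H := recursive_comp rG (recursive_pair recursive_fst (recursive_nsnd _ recursive_snd)).
  by apply: (recursive_ext H) => w; rewrite nfstK nsndK.
apply: recursive_ext (@recursive_iteri f n (fun z _ r => G z r) rf rn rG') _.
by move=> z; elim: (n z) => //= m ->.
Qed.

Lemma recursive_add f g : recursive f -> recursive g -> recursive (fun z => f z + g z).
Proof.
move=> rf rg.
have H := @recursive_iter f g (fun _ r => r.+1) rf rg.
apply: recursive_ext (H (recursive_S _ recursive_snd)) _ => z.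
by elim: (g z) => [|m /= ->]; rewrite ?addn0 ?addnS.
Qed.

Lemma recursive_sub f g : recursive f -> recursive g -> recursive (fun z => f z - g z).
Proof.
move=> rf rg.
have H := @recursive_iter f g (fun _ r => r.-1) rf rg.
apply: recursive_ext (H (recursive_pred _ recursive_snd)) _ => z.
by elim: (g z) => [|m /= ->]; rewrite ?subn0 ?subnS.
Qed.

Lemma recursive_eqb (f g : nat -> nat) : recursive f -> recursive g ->
  recursive (fun z => f z == g z : nat).
Proof.
have eq0 h : recursive h -> recursive (fun z => h z == 0 : nat).
  move=> rh; have H := @recursive_iteri (fun=> 1) h (fun _ _ _ => 0).
  apply: recursive_ext (H (recursive_const 1) rh (recursive_const 0)) _.
  by move=> z; case: (h z).
move=> rf rg; have H := eq0 _ (recursive_add _ _ (recursive_sub _ _ rf rg) (recursive_sub _ _ rg rf)).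
by apply: recursive_ext H _ => z; rewrite addn_eq0 -!/(_ <= _) -eqn_leq.
Qed.

Lemma recursive_leq (f g : nat -> nat) : recursive f -> recursive g ->
  recursive (fun z => f z <= g z : nat).
Proof.
move=> rf rg; exact: recursive_eqb (recursive_sub _ _ rf rg) (recursive_const 0).
Qed.

Lemma recursive_odd f : recursive f -> recursive (fun z => odd (f z) : nat).
Proof.
move=> rf; have H := @recursive_iter (fun=> 0) f (fun _ r => 1 - r).
apply: recursive_ext (H (recursive_const 0) rf (recursive_sub _ _ (recursive_const 1) recursive_snd)) _.
by move=> z; elim: (f z) => //= m ->; case: (odd m).
Qed.

Lemma recursive_double f : recursive f -> recursive (fun z => (f z).*2).
Proof.
by move=> rf; apply: recursive_ext (recursive_add _ _ rf rf) _ => z; rewrite addnn.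
Qed.

Lemma recursive_half f : recursive f -> recursive (fun z => (f z)./2).
Proof.
move=> rf; have H := @recursive_iteri (fun=> 0) f (fun _ k r => r + odd k).
apply: recursive_ext (H (recursive_const 0) rf _) _.
  exact: recursive_add (recursive_nsnd _ recursive_snd)
    (recursive_odd _ (recursive_nfst _ recursive_snd)).
move=> z; elim: (f z) => //= m ->.
by rewrite uphalf_half addnC.
Qed.

Lemma iota0S m : iota 0 m.+1 = iota 0 m ++ [:: m].
Proof. by rewrite -addn1 iotaD. Qed.

Lemma recursive_has (P : nat -> nat -> bool) n :
  recursive n -> recursive (fun w => P (nfst w) (nsnd w) : nat) ->
  recursive (fun z => has (fun k => P z k) (iota 0 (n z)) : nat).
Proof.
move=> rn rP.
have H := @recursive_iteri (fun=> 0) n (fun z k r => if P z k then 1 else r) (recursive_const 0) rn.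
apply: recursive_ext (H _) _.
  apply: (@recursive_if (fun w => P (nfst w) (nfst (nsnd w)))).
  - have H' := recursive_comp rP (recursive_pair recursive_fst (recursive_nfst _ recursive_snd)).
    by apply: (recursive_ext H') => w; rewrite nfstK nsndK.
  - exact: recursive_const.
  - exact: recursive_nsnd _ recursive_snd.
move=> z; elim: (n z) => // m IH.
by rewrite iota0S has_cat /= orbF IH; case: (P z m); rewrite ?orbT ?orbF.
Qed.

Lemma recursive_count (P : nat -> nat -> bool) n :
  recursive n -> recursive (fun w => P (nfst w) (nsnd w) : nat) ->
  recursive (fun z => count (fun k => P z k) (iota 0 (n z))).
Proof.
move=> rn rP.
have H := @recursive_iteri (fun=> 0) n (fun z k r => P z k + r) (recursive_const 0) rn.
apply: recursive_ext (H _) _.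
  apply: recursive_add; last exact: recursive_nsnd _ recursive_snd.
  have H' := recursive_comp rP (recursive_pair recursive_fst (recursive_nfst _ recursive_snd)).
  by apply: (recursive_ext H') => w; rewrite nfstK nsndK.
move=> z; elim: (n z) => // m IH.
by rewrite iota0S count_cat /= IH addn0 addnC.
Qed.

Lemma recursive_find (P : nat -> nat -> bool) n :
  recursive n -> recursive (fun w => P (nfst w) (nsnd w) : nat) ->
  recursive (fun z => find (fun k => P z k) (iota 0 (n z))).
Proof.
move=> rn rP.
(* The first hit in [iota 0 (n z)] is at the number of [k] such that no [j <= k] is a hit; without
   any hit both sides are [n z]. *)
have H := @recursive_count (fun z k => ~~ has (fun j => P z j) (iota 0 k.+1)) n rn.
apply: recursive_ext (H _) _.
  apply: (@recursive_negb (fun w => has (fun j => P (nfst w) j) (iota 0 (nsnd w).+1))).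
  apply: (@recursive_has (fun w j => P (nfst w) j)); first exact: recursive_S recursive_snd.
  have H' := recursive_comp rP (recursive_pair (recursive_nfst _ recursive_fst) recursive_snd).
  by apply: (recursive_ext H') => w; rewrite nfstK nsndK.
move=> z; elim: (n z) => // m IH.
have E a : count a [:: m] = a m by rewrite /= addn0.
rewrite iota0S count_cat IH find_cat size_iota E.
rewrite iota0S has_cat [has _ [:: m]]/= orbF.
case: ifPn => [_|h]; first by rewrite addn0.
by rewrite (hasNfind h) size_iota /=; case: (P z m).
Qed.

Ltac rec :=
  cbv beta;
  lazymatch goal with
  | |- recursive (fun z => z) => exact recursive_id
  | |- recursive (fun _ => ?c) => exact (recursive_const c)
  | |- recursive nfst => exact recursive_fst
  | |- recursive nsnd => exact recursive_snd
  | |- recursive (fun z => (@?f z).+1) => apply (recursive_S f); rec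
  | |- recursive (fun z => (@?f z).-1) => apply (recursive_pred f); rec
  | |- recursive (fun z => (@?f z).*2) => apply (recursive_double f); rec
  | |- recursive (fun z => (@?f z)./2) => apply (recursive_half f); rec
  | |- recursive (fun z => nfst (@?f z)) => apply (recursive_nfst f); rec
  | |- recursive (fun z => nsnd (@?f z)) => apply (recursive_nsnd f); rec
  | |- recursive (fun z => npair (@?f z) (@?g z)) =>
      apply (@recursive_pair f g); rec
  | |- recursive (fun z => nat_of_bool (odd (@?f z))) => apply (recursive_odd f); rec
  | |- recursive (fun z => nat_of_bool (~~ (@?b z))) => apply (recursive_negb b); rec
  | |- recursive (fun z => nat_of_bool ((@?b z) && (@?c z))) =>
      apply (recursive_andb b c); rec
  | |- recursive (fun z => nat_of_bool ((@?b z) || (@?c z))) =>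
      apply (recursive_orb b c); rec
  | |- recursive (fun z => nat_of_bool ((@?f z) == (@?g z))) =>
      apply (recursive_eqb f g); rec
  | |- recursive (fun z => nat_of_bool ((@?f z) <= (@?g z))) =>
      apply (recursive_leq f g); rec
  | |- recursive (fun z => (@?f z) + (@?g z)) => apply (recursive_add f g); rec
  | |- recursive (fun z => (@?f z) - (@?g z)) => apply (recursive_sub f g); rec
  | |- recursive (fun z => nat_of_bool (has (fun k => @?P z k) (iota 0 (@?n z)))) =>
      apply (recursive_has P n); rec
  | |- recursive (fun z => count (fun k => @?P z k) (iota 0 (@?n z))) =>
      apply (recursive_count P n); rec
  | |- recursive (fun z => find (fun k => @?P z k) (iota 0 (@?n z))) =>
      apply (recursive_find P n); rec
  | |- recursive (fun z => iter (@?n z) (fun r => @?G z r) (@?f z)) =>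
      apply (recursive_iter f n G); rec
  | |- recursive (fun z => iteri (@?n z) (fun k r => @?G z k r) (@?f z)) =>
      apply (recursive_iteri f n G); rec
  | H : recursive ?h |- recursive (fun z => ?h (@?f z)) =>
      apply (@recursive_comp h f H); rec
  | H : recursive (fun w => nat_of_bool (?h w)) |- recursive (fun z => nat_of_bool (?h (@?f z))) =>
      apply (@recursive_comp (fun w => nat_of_bool (h w)) f H); rec
  | _ => try assumption
  end.

(** * Closure properties of r.e. predicates *)

Lemma reP (A : set nat) :
  re A <-> exists2 R : nat -> bool, recursive (fun z => R z : nat) &
    forall x, A x <-> exists t, R (npair x t).
Proof.
split=> [[->|[f rf ->]]|[R rR AR]].
- exists (fun=> false); first rec.
  by move=> x; split=> // -[].
- exists (fun z => f (nsnd z) == nfst z); first rec.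
  move=> x; split=> [[t _ <-]|[t]].
    by exists t; rewrite nfstK nsndK.
  by rewrite nfstK nsndK => /eqP <-; exists t.
have [[a Aa]|A0] := EM (exists a, A a); last first.
  by left; rewrite predeqE => x; split=> // Ax; case: A0; exists x.
(* Stages [z] that verify nothing output the known element [a]. *)
right; exists (fun z => if R z then nfst z else a); first by apply: (recursive_if R); rec.
rewrite predeqE => x; split=> [/AR[t Rt]|[z _ <-]].
  by exists (npair x t); rewrite // Rt nfstK.
case: ifP => // Rz; apply/AR; exists (nsnd z); by rewrite npairK.
Qed.

Lemma re_bool (b : nat -> bool) :
  recursive (fun z => b z : nat) -> re (fun z => b z : Prop).
Proof.
move=> rb; apply/reP; exists (fun z => b (nfst z)); first rec.
move=> x; split=> [bx|[t]]; last by rewrite nfstK.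
by exists 0; rewrite nfstK.
Qed.

Lemma re_eq (f g : nat -> nat) : recursive f -> recursive g -> re (fun z => f z = g z).
Proof.
move=> rf rg.
have -> : (fun z => f z = g z) = (fun z => (f z == g z) : Prop).
  by apply/funext => z; apply/propext; split=> /eqP.
by apply: re_bool; rec.
Qed.

Lemma re_and (P Q : nat -> Prop) : re P -> re Q -> re (fun z => P z /\ Q z).
Proof.
move=> /reP[R rR PR] /reP[S rS QS]; apply/reP.
exists (fun w => R (npair (nfst w) (nfst (nsnd w))) &&
                 S (npair (nfst w) (nsnd (nsnd w)))); first rec.
move=> x; split=> [[/PR[t Rt] /QS[u Su]]|[t]].
  by exists (npair t u); rewrite !(nfstK, nsndK) Rt Su.
by rewrite nfstK nsndK => /andP[Rt St]; split; [apply/PR|apply/QS]; eexists; eassumption.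
Qed.

Lemma re_or (P Q : nat -> Prop) : re P -> re Q -> re (fun z => P z \/ Q z).
Proof.
move=> /reP[R rR PR] /reP[S rS QS]; apply/reP.
exists (fun w => R w || S w); first rec.
move=> x; split=> [[/PR[t Rt]|/QS[t St]]|[t]].
- by exists t; rewrite Rt.
- by exists t; rewrite St orbT.
by move=> /orP[Rt|St]; [left; apply/PR|right; apply/QS]; exists t.
Qed.

Lemma re_ex (P : nat -> nat -> Prop) :
  re (fun w => P (nfst w) (nsnd w)) -> re (fun z => exists k, P z k).
Proof.
move=> /reP[R rR PR]; apply/reP.
exists (fun w => R (npair (npair (nfst w) (nfst (nsnd w))) (nsnd (nsnd w)))); first rec.
move=> x; split=> [[k Pk]|[t]].
  have /PR[t Rt] : P (nfst (npair x k)) (nsnd (npair x k)) by rewrite nfstK nsndK.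
  by exists (npair k t); rewrite !(nfstK, nsndK).
rewrite nfstK nsndK => Rt; exists (nfst t).
have : P (nfst (npair x (nfst t))) (nsnd (npair x (nfst t))).
  by apply/PR; eexists; eassumption.
by rewrite nfstK nsndK.
Qed.

Lemma re_comp (P : nat -> Prop) f : re P -> recursive f -> re (fun z => P (f z)).
Proof.
move=> /reP[R rR PR] rf; apply/reP.
exists (fun w => R (npair (f (nfst w)) (nsnd w))); first rec.
move=> x; split=> [/PR[t Rt]|[t]].
  by exists t; rewrite nfstK nsndK.
by rewrite nfstK nsndK => Rt; apply/PR; exists t.
Qed.

Lemma re_comp2 (P : nat -> nat -> Prop) f g :
  re (fun w => P (nfst w) (nsnd w)) -> recursive f -> recursive g ->
  re (fun z => P (f z) (g z)).
Proof.
move=> rP rf rg; have := re_comp _ (fun z => npair (f z) (g z)) rP.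
have -> : (fun z => P (nfst (npair (f z) (g z))) (nsnd (npair (f z) (g z))))
   = (fun z => P (f z) (g z)).
  by apply/funext => z; rewrite nfstK nsndK.
by apply; rec.
Qed.

Ltac retac :=
  cbv beta;
  lazymatch goal with
  | |- re (fun z => (@?P z) /\ (@?Q z)) => apply (re_and P Q); retac
  | |- re (fun z => (@?P z) \/ (@?Q z)) => apply (re_or P Q); retac
  | |- re (fun z => exists k, @?P z k) => apply (re_ex P); retac
  | |- re (fun z => is_true (@?b z)) => apply (re_bool b); rec
  | |- re (fun z => (@?f z) = (@?g z)) => apply (re_eq f g); rec
  | H : re ?P |- re (fun z => ?P (@?f z)) => apply (re_comp P f H); rec
  | H : re (fun w => ?P (nfst w) (nsnd w)) |- re (fun z => ?P (@?f z) (@?g z)) =>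
      apply (re_comp2 P f g H); rec
  | H : uniformly_re ?P |- re (fun z => ?P (@?f z) (@?g z)) =>
      apply (re_comp2 P f g H); rec
  | _ => try assumption
  end.

(** * Decoding finite data sequences *)

Definition code_tail (c : nat) : nat := nsnd c.-1.

(** Each cons in [code_seq] is the successor of a pair, hence the predecessors; past the end the
    reading is 0, the code of a pause. *)
Definition code_entry (c j : nat) : nat := nfst (iter j code_tail c).-1.

(** The code of a sequence bounds its length, so the first [c] positions exhaust the data. *)
Definition seen (c x : nat) : bool :=
  has (fun j => code_entry c j == x.+1) (iota 0 c).

Lemma recursive_seen f g : recursive f -> recursive g ->
  recursive (fun z => seen (f z) (g z) : nat).
Proof. by move=> rf rg; rewrite /seen /code_entry /code_tail; rec. Qed.

Lemma size_code_seq s : size s <= code_seq s.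
Proof.
elim: s => //= a s IH; apply: leq_ltn_trans IH _; rewrite ltnS.
have /leP := Cantor.to_nat_non_decreasing (code_option a) (code_seq s).
exact: leq_trans (leq_addr _ _).
Qed.

Lemma code_entry_seq s j : code_entry (code_seq s) j = nth 0 (map code_option s) j.
Proof.
rewrite /code_entry; elim: s j => [|a s IH] [|j] //.
- rewrite nth_nil; have -> : iter j.+1 code_tail (code_seq [::]) = 0 by elim: j => //= j ->.
  by [].
- by rewrite /= nfstK.
- rewrite iterSr; have -> : code_tail (code_seq (a :: s)) = code_seq s by rewrite /code_tail /= nsndK.
  exact: IH.
Qed.

Lemma seen_code s x : seen (code_seq s) x = (Some x \in s).
Proof.
apply/hasP/idP => [[j _]|xs].
  rewrite code_entry_seq => /eqP E.
  have js : j < size s.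
    by rewrite ltnNge; apply/negP => sj; move: E; rewrite nth_default ?size_map.
  move: E; rewrite (nth_map None) // => E.
  have -> : Some x = nth None s j by case: nth E => //= y [->].
  exact: mem_nth.
exists (index (Some x) s).
  by rewrite mem_iota /= add0n (leq_trans _ (size_code_seq s)) // index_mem.
by rewrite code_entry_seq (nth_map None) ?index_mem // nth_index.
Qed.

(** * Texts and learners *)

Definition eventually (P : nat -> Prop) : Prop := exists n0, forall n, n0 <= n -> P n.

Lemma eventually_and P Q : eventually P -> eventually Q -> eventually (fun n => P n /\ Q n).
Proof.
move=> [n Hn] [m Hm]; exists (maxn n m) => k; rewrite geq_max => /andP[nk mk].
by split; [apply: Hn|apply: Hm].
Qed.

Lemma eventually_mono (P Q : nat -> Prop) :
  (forall n, P n -> Q n) -> eventually P -> eventually Q.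
Proof. by move=> PQ [n H]; exists n => m /H /PQ. Qed.

Lemma eventually_below (P : nat -> nat -> Prop) e :
  (forall k, k < e -> eventually (P k)) -> eventually (fun n => forall k, k < e -> P k n).
Proof.
elim: e => [|e IH] H; first by exists 0.
have H1 := IH (fun k ke => H k (ltnW ke)).
apply: eventually_mono (eventually_and _ _ H1 (H e (ltnSn e))) => n [Hn He] k.
by rewrite ltnS leq_eqVlt => /orP[/eqP ->|/Hn].
Qed.

Lemma eventually_code (T : text) m : eventually (fun n => m <= code_seq (mkseq T n)).
Proof.
exists m => n mn; apply: leq_trans mn _.
by rewrite -{1}(size_mkseq T n) size_code_seq.
Qed.

Lemma eventually_seen T L x : text_for T L -> L x ->
  eventually (fun n => seen (code_seq (mkseq T n)) x).
Proof.
move=> -> [m Tm]; exists m.+1 => n mn; rewrite seen_code -Tm.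
by rewrite /mkseq map_f // mem_iota.
Qed.

Lemma never_seen T L x n : text_for T L -> ~ L x -> ~~ seen (code_seq (mkseq T n)) x.
Proof.
move=> -> NL; rewrite seen_code; apply/negP => /mapP[m _ E].
by apply: NL; exists m.
Qed.

Definition index_learner (h : nat -> nat) : learner := fun s => Some (h (code_seq s)).

Lemma recursive_index_learner h : recursive h -> recursive_learner (index_learner h).
Proof. by move=> rh; exists (fun c => (h c).+1); first rec. Qed.

Lemma find_first (p : pred nat) n e :
  e < n -> p e -> (forall k, k < e -> ~~ p k) -> find p (iota 0 n) = e.
Proof.
move=> en pe He.
have hp : has p (iota 0 n) by apply/hasP; exists e; rewrite // mem_iota.
have fn : find p (iota 0 n) < n by rewrite -[ltnRHS](size_iota 0 n) -has_find.
have := nth_find 0 hp; rewrite nth_iota // add0n => pf.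
case: (ltngtP (find p (iota 0 n)) e) => // [/He|lt]; first by rewrite pf.
by have := before_find 0 lt; rewrite nth_iota // add0n pe.
Qed.

(* The learner conjectures the least candidate that the data do not reject at
   present; [reject] may change its mind finitely often on each candidate. *)
Lemma ex_learnable_least W eta (V : nat -> set nat) (reject : nat -> nat -> bool) C :
  acceptable W -> uniformly_re V ->
  recursive (fun w => reject (nfst w) (nsnd w) : nat) ->
  (forall L T, C L -> text_for T L -> exists e,
    [/\ eta_closure eta (V e) = L,
        eventually (fun n => ~~ reject (code_seq (mkseq T n)) e)
      & forall k, k < e -> eventually (fun n => reject (code_seq (mkseq T n)) k)]) ->
  ex_learnable W eta C.
Proof.
move=> [_ accW] rV rR HC; have [f rf Vf] := accW V rV.
(* The code [c] of the data bounds the search; it grows with the data and eventually exceeds the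
   right candidate. *)
exists (index_learner (fun c => f (find (fun e => ~~ reject c e) (iota 0 c)))).
  by apply: recursive_index_learner; rec.
move=> L T CL TL; have [e [VL He Hk]] := HC L T CL TL.
exists (f e); first by rewrite -Vf.
have [n0 H] := eventually_and _ _ (eventually_and _ _ He (eventually_below _ _ Hk))
                 (eventually_code T e.+1).
exists n0 => n /H[[ne nk] ce]; rewrite /index_learner (find_first _ _ e) //.
by move=> k /nk ->.
Qed.

Lemma ex_learns_vac W eta M C : ex_learns W eta M C -> vac_learns W eta M C.
Proof.
move=> exM; split=> L T CL TL; have [e We [n0 Me]] := exM L T CL TL.
  by exists n0 => n /Me ->; exists e.
apply: (@sub_finite_set _ _ ([set M (mkseq T n) | n in `I_n0] `|` [set Some e])).
  move=> _ [n _ <-]; have [nn|/Me ->] := ltnP n n0; last by right.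
  by left; exists n.
rewrite finite_setU; split; last exact: finite_set1.
exact/finite_image/finite_II.
Qed.

Lemma ex_learnable_vac W eta C : ex_learnable W eta C -> vac_learnable W eta C.
Proof. by move=> [M rM /ex_learns_vac vM]; exists M. Qed.

Lemma vac_learnable_bc W eta C : vac_learnable W eta C -> bc_learnable W eta C.
Proof. by move=> [M rM [bM _]]; exists M. Qed.

Lemma ex_learnable_sub W eta C C' : C' `<=` C -> ex_learnable W eta C -> ex_learnable W eta C'.
Proof. by move=> CC [M rM HM]; exists M => // L T /CC; exact: HM. Qed.

(** * Locking sequences *)

Definition over (L : set nat) (s : seq (option nat)) : Prop :=
  forall x, Some x \in s -> L x.

Lemma over_cat L s t : over L s -> over L t -> over L (s ++ t).
Proof. by move=> Ls Lt x; rewrite mem_cat => /orP[/Ls|/Lt]. Qed.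

Definition append_text (s : seq (option nat)) (T : text) : text :=
  fun n => if n < size s then nth None s n else T (n - size s).

Lemma mkseq_append_text s T n :
  mkseq (append_text s T) (size s + n) = s ++ mkseq T n.
Proof.
apply: (@eq_from_nth _ None) => [|i]; first by rewrite size_cat !size_mkseq.
rewrite size_mkseq => ile; rewrite nth_mkseq // nth_cat /append_text.
by case: ifP => // si; rewrite nth_mkseq // ltn_subLR // leqNgt si.
Qed.

Lemma append_text_for s T L : over L s -> text_for T L -> text_for (append_text s T) L.
Proof.
move=> Ls TL; rewrite /text_for predeqE => x; split=> [|[n]].
  rewrite {1}TL => -[n Tn]; exists (size s + n).
  by rewrite /append_text -ltn_subRL subnn addKn.
rewrite /append_text; case: ifP => [ns E|_ E]; last by rewrite TL; exists (n - size s).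
by apply: Ls; rewrite -E mem_nth.
Qed.

(* Building a text for [L] by successive extensions, interleaved with an
   exhaustive listing of [L]. *)
Lemma extension_text (L : set nat) (Q : seq (option nat) -> seq (option nat) -> Prop) s0 :
  over L s0 ->
  (forall s, over L s -> exists2 t, over L t & Q (s0 ++ s) (s0 ++ s ++ t)) ->
  exists2 T, text_for T L &
    forall n, exists k m, [/\ n <= k, k <= m & Q (mkseq T k) (mkseq T m)].
Proof.
move=> Ls0 HQ.
have [ext Hext] : {ext : seq (option nat) -> seq (option nat) &
    forall s, over L s -> over L (ext s) /\ Q (s0 ++ s) (s0 ++ s ++ ext s)}.
  apply: (@boolp.choice _ _ (fun s t => over L s -> over L t /\ Q (s0 ++ s) (s0 ++ s ++ t))) => s.
  have [/HQ[t Lt Qt]|NL] := EM (over L s); first by exists t.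
  by exists [::].
pose item n := if `[< L n >] then Some n else None.
have [S [S0 SS]] : exists S : nat -> seq (option nat),
    S 0 = [::] /\ forall n, S n.+1 = S n ++ ext (S n) ++ [:: item n].
  by exists (fix S n := if n is m.+1 then S m ++ ext (S m) ++ [:: item m] else [::]).
have Litem n : over L [:: item n].
  by move=> x; rewrite inE /item; case: asboolP => // Ln /eqP[->].
have LS n : over L (S n).
  elim: n => [|n IH]; first by rewrite S0.
  rewrite SS.  by apply: over_cat => //; apply: over_cat => //; exact: (Hext _ IH).1.
have szS n : n <= size (S n).
  elim: n => // n IH; rewrite SS !size_cat addnA addn1 ltnS.
  exact: leq_trans IH (leq_addr _ _).
have pS n m : n <= m -> exists r, S m = S n ++ r.
  elim: m => [|m IH].
    by rewrite leqn0 => /eqP ->; exists [::]; rewrite cats0.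
  rewrite leq_eqVlt => /orP[/eqP ->|]; first by exists [::]; rewrite cats0.
  by rewrite ltnS SS => /IH[r ->]; eexists; rewrite -catA.
(* [S n.+1] has more than [n] entries, so the default [None] is never read. *)
pose T n := nth None (s0 ++ S n.+1) n.
have TS n i : i < size s0 + size (S n) -> T i = nth None (s0 ++ S n) i.
  move=> iS; rewrite /T.
  have iSi : i < size s0 + size (S i.+1) by rewrite ltn_addl // szS.
  case: (leqP n i.+1) => [/pS|/ltnW /pS] [r E]; rewrite E catA.
    by rewrite nth_cat size_cat iS.
  by rewrite [RHS]nth_cat size_cat iSi.
have mkT n r r' : S n = r ++ r' -> mkseq T (size s0 + size r) = s0 ++ r.
  move=> E; apply: (@eq_from_nth _ None) => [|i]; rewrite size_mkseq ?size_cat //.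
  move=> i_lt; rewrite nth_mkseq // (TS n).
    by rewrite E catA nth_cat size_cat i_lt.
  by apply: leq_trans i_lt _; rewrite leq_add2l E size_cat leq_addr.
exists T.
  rewrite /text_for predeqE => x; split=> [Lx|[n]].
    exists (size s0 + (size (S x) + size (ext (S x)))).
    rewrite (TS x.+1); last by rewrite ltn_add2l SS !size_cat /= addnA addn1.
    rewrite SS nth_cat ltnNge leq_addr /= addKn nth_cat ltnNge leq_addr /= addKn.
    by rewrite nth_cat ltnn subnn /= /item asboolT.
  rewrite /T => E.
  have : Some x \in s0 ++ S n.+1.
    rewrite -E mem_nth // size_cat.
    by rewrite ltn_addl // szS.
  exact: (over_cat _ _ _ Ls0 (LS n.+1)).
move=> n; exists (size s0 + size (S n)), (size s0 + size (S n ++ ext (S n))); split.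
- exact: leq_trans (szS n) (leq_addl _ _).
- by rewrite leq_add2l size_cat leq_addr.
rewrite (mkT n _ [::]) ?cats0 // (mkT n.+1 _ [:: item n]) ?SS ?catA //.
by rewrite -catA; exact: (Hext _ (LS n)).2.
Qed.

Definition conjectures (W : nat -> set nat) eta (o : option nat) (L : set nat) : Prop :=
  exists2 e, o = Some e & eta_closure eta (W e) = L.

Lemma exists_text_for L : exists T, text_for T L.
Proof.
exists (fun n => if `[< L n >] then Some n else None).
rewrite /text_for predeqE => x; split=> [Lx|[n]].
  by exists x; rewrite asboolT.
by case: asboolP => // Ln [<-].
Qed.

(** Otherwise every sequence over [A] extends to one with a wrong conjecture, and [extension_text]
    yields a text for [A] on which [M] errs infinitely often. *)
Lemma bc_locking W eta M C A : bc_learns W eta M C -> C A ->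
  exists2 s, over A s & forall t, over A t -> conjectures W eta (M (s ++ t)) A.
Proof.
move=> bM CA; apply: contrapT => N.
have [||T TA HT] := @extension_text A (fun _ s => ~ conjectures W eta (M s) A) [::].
- by move=> x.
- move=> s As; apply: contrapT => Ns; apply: N; exists s => // t At.
  by apply: contrapT => Mt; apply: Ns; exists t.
have [n0 Mn] := bM A T CA TA; have [k [m [nk km]]] := HT n0.
by case; exact: Mn (leq_trans nk km).
Qed.

(** On a text for [L] that begins with [s], the conjectures must eventually denote [L], yet all of
    them past [s] denote [A]. *)
Lemma bc_locking_extension W eta M C A L s : bc_learns W eta M C -> C L ->
  over L s -> (forall t, over L t -> conjectures W eta (M (s ++ t)) A) -> L = A.
Proof.
move=> bM CL Ls HA; have [T TL] := exists_text_for L.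
have [n0 Hn] := bM L _ CL (append_text_for _ _ _ Ls TL).
have [e Me <-] := Hn _ (leq_addl (size s) n0).
have LT : over L (mkseq T n0).
  by move=> x /mapP[i _ E]; rewrite TL; exists i.
have [e' Me' <-] := HA _ LT.
by move: Me; rewrite mkseq_append_text Me' => -[->].
Qed.

(** The telltale is the content of a locking sequence for [A]; sequences over a subset [L] of [A]
    are also over [A], so the lock holds for them. *)
Lemma bc_telltale W eta C A : bc_learnable W eta C -> C A ->
  exists2 D : seq nat, (forall x, x \in D -> A x) &
    forall L, C L -> L `<=` A -> (forall x, x \in D -> L x) -> L = A.
Proof.
move=> [M rM bM] CA; have [s As Hs] := bc_locking _ _ _ _ _ bM CA.
have sD x : (x \in pmap id s) = (Some x \in s) by rewrite mem_pmap map_id.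
exists (pmap id s) => [x|L CL LA DL]; first by rewrite sD; exact: As.
apply: (bc_locking_extension _ _ _ _ _ _ s bM CL) => [x xs|t Lt].
  by apply: DL; rewrite sD.
by apply: Hs => x /Lt /LA.
Qed.

Lemma finite_eventually (T : eqType) (F : set T) (P : T -> nat -> Prop) :
  finite_set F -> (forall v, F v -> eventually (P v)) ->
  eventually (fun n => forall v, F v -> P v n).
Proof.
move=> /finite_seqP[l ->]; elim: l => [|v l IH] H; first by exists 0.
have Hl : eventually (fun n => forall v, v \in l -> P v n).
  by apply: IH => w wl; apply: H; rewrite /= inE wl orbT.
have Hv : eventually (P v) by apply: H; rewrite /= mem_head.
apply: eventually_mono (eventually_and _ _ Hv Hl) => n [Pv Pl] w /=.
by rewrite inE => /orP[/eqP ->|/Pl].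
Qed.

(** Past a locking sequence all conjectures are right. If fresh outputs always remained reachable,
    [extension_text] would give a text for [A] with infinitely many outputs. So some extension [s]
    admits only outputs already made, and [E] consists of the correct ones among these. *)
Lemma vac_locking W eta M C A : vac_learns W eta M C -> C A ->
  exists s (E : seq (option nat)),
    [/\ over A s, forall v, v \in E -> conjectures W eta v A
      & forall t, over A t -> M (s ++ t) \in E].
Proof.
move=> [bM vM] CA; have [s0 As0 Hs0] := bc_locking _ _ _ _ _ bM CA.
(* Only nonempty prefixes, matching the outputs counted by [vac_learns]. *)
pose vals s := [seq M (take i s) | i <- iota 1 (size s)].
apply: contrapT => N.
have [//||T TA HT] := @extension_text A (fun s s' => M s' \notin vals s) s0.
  move=> s As; apply: contrapT => Ns; apply: N.
  exists (s0 ++ s), [seq v <- vals (s0 ++ s) | `[< conjectures W eta v A >]].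
  split=> [|v|t At]; first exact: over_cat.
    by rewrite mem_filter => /andP[/asboolP].
  rewrite mem_filter -catA asboolT /=; last by apply: Hs0; exact: over_cat.
  by apply: contrapT => /negP Mt; apply: Ns; exists t => //.
have : eventually (fun n => forall v, [set M (mkseq T n) | n in [set n | 1 <= n]] v ->
    0 < n /\ v \in vals (mkseq T n)).
  apply: finite_eventually; first exact: vM CA TA.
  move=> _ [k /= k1 <-]; exists k => n kn; split; first exact: leq_trans k1 kn.
  apply/mapP; exists k; first by rewrite mem_iota size_mkseq k1 add1n ltnS.
  by rewrite /mkseq -map_take take_iota (minn_idPl kn).
move=> [n0 Hn0]; have [k [m [nk km]]] := HT n0.+1.
have k0 := leq_trans (ltn0Sn n0) nk.
have [|_ ->//] := Hn0 k (ltnW nk) (M (mkseq T m)).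
by exists m => //=; exact: leq_trans k0 km.
Qed.

(** The learner conjectures the closure of the data. Each class inside [L] has an element below [n],
    so the conjecture is right once the data contain all of [L] below [n]. *)
Lemma bc_learnable_content W eta C : acceptable W ->
  (forall L, C L -> (forall x y, L x -> eta x y -> L y) /\
     exists n, forall x, L x -> exists2 w, w < n & L w /\ eta w x) ->
  bc_learnable W eta C.
Proof.
move=> [_ accW] HC.
have rV : uniformly_re (fun c x => seen c x).
  rewrite /uniformly_re /mkset; apply: (re_bool (fun z => seen (nfst z) (nsnd z))).
  by apply: recursive_seen; rec.
have [f rf Vf] := accW _ rV.
exists (index_learner f); first exact: recursive_index_learner.
move=> L T CL TL; have [cL [n Ln]] := HC L CL.
have [n0 Hn0] : eventually (fun m => forall w, w < n -> L w -> seen (code_seq (mkseq T m)) w).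
  apply: (eventually_below (fun w m => L w -> seen (code_seq (mkseq T m)) w)) => w _.
  have [Lw|NL] := EM (L w); last by exists 0.
  by apply: eventually_mono (eventually_seen _ _ _ TL Lw).
exists n0 => m /Hn0 Hm; exists (f (code_seq (mkseq T m))) => //.
rewrite -Vf predeqE => y; split=> [[x]|/Ln[w wn [Lw wy]]].
  have [Lx _|NL] := EM (L x); first exact: cL.
  by rewrite (negbTE (never_seen _ _ _ _ TL NL)).
by exists w => //; exact: Hm.
Qed.

(** * Families of closed sets *)

Lemma uniformly_reP (B : nat -> set nat) :
  uniformly_re B = re (fun w => B (nfst w) (nsnd w)).
Proof. by []. Qed.

Lemma eta_closedP eta (A : set nat) : Equivalence eta ->
  eta_closed eta A <-> forall x y, A x -> eta x y -> A y.
Proof.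
move=> [er es et]; split=> [[X XC ->] x y [C XC' Cx] xy|cA].
  exists C => //; have [z _ E] := XC _ XC'; rewrite -E in Cx *.
  exact: et Cx xy.
exists (eta @` A); first by move=> _ [x _ <-]; exists x.
rewrite predeqE => y; split=> [Ay|[_ [x Ax <-]]]; last exact: cA.
by exists (eta y); [exists y|exact: er].
Qed.

Lemma seq_leq_bigmax (l : seq nat) i : i \in l -> i <= \max_(j <- l) j.
Proof. by move=> il; exact: (@leq_bigmax_seq _ l xpredT id i il isT). Qed.

Lemma eta_family_range eta (B : nat -> set nat) : Equivalence eta ->
  uniformly_re B -> injective B ->
  (forall i x y, B i x -> eta x y -> B i y) -> eta_family eta (range B).
Proof.
move=> eqv rB iB cB; split; last by exists B.
- move=> fB; apply: infinite_nat.
  have -> : [set: nat] = B @^-1` range B.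
    by rewrite predeqE => i; split=> // _; exists i.
  apply: finite_preimage fB; move=> ? ? _ _; exact: iB.
- by move=> _ [i _ <-]; apply/eta_closedP => // x y; exact: cB.
Qed.

(** The numberings are interleaved, [B] on even and [B'] on odd indices; disjointness keeps the
    result one-one. *)
Lemma eta_family_union eta C C' : Equivalence eta ->
  eta_family eta C -> eta_family eta C' -> C `&` C' = set0 -> eta_family eta (C `|` C').
Proof.
move=> eqv [infC cC [B [rB iB CB]]] [_ cC' [B' [rB' iB' CB']]] CC0.
have disj i j : B i <> B' j.
  move=> E; have : (C `&` C') (B i) by rewrite CB CB'; split; [exists i|rewrite E; exists j].
  by rewrite CC0.
split.
- by apply: sub_infinite_set infC => L; left.
- by move=> L [/cC|/cC'].
exists (fun i x => (~~ odd i /\ B i./2 x) \/ (odd i /\ B' i./2 x)); split.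
- by rewrite uniformly_reP; retac.
- have D i : (fun x => (~~ odd i /\ B i./2 x) \/ (odd i /\ B' i./2 x)) =
             if odd i then B' i./2 else B i./2.
    rewrite predeqE => x; case: (odd i); split=> //; try by move=> [[]|[]].
      by right.
    by left.
  move=> i j /=; rewrite !D => E.
  rewrite -[i]odd_double_half -[j]odd_double_half.
  move: E; case: (odd i); case: (odd j) => E.
  + by rewrite (iB' _ _ E).
  + by case: (disj j./2 i./2).
  + by case: (disj i./2 j./2).
  + by rewrite (iB _ _ E).
rewrite predeqE CB CB' => L; split=> [[[i _ <-]|[i _ <-]]|[i _ <-]].
- exists i.*2 => //; rewrite predeqE => x; rewrite odd_double doubleK.
  by split=> [[[]|[]]|] //; left.
- exists i.*2.+1 => //; rewrite predeqE => x; rewrite /= odd_double uphalf_double.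
  by split=> [[[]|[]]|] //; right.
- case: (boolP (odd i)) => oi; [right|left]; exists i./2 => //; rewrite predeqE => x.
    by split=> [|[[]|[]]] //; right.
  by split=> [|[[]|[]]] //; left.
Qed.

Lemma not_eta_infinite eta (A : set nat) : Equivalence eta ->
  (forall x y, A x -> eta x y -> A y) -> ~ eta_infinite eta A ->
  exists n, forall x, A x -> exists2 w, w < n & A w /\ eta w x.
Proof.
move=> [er es et] cA nA; apply: contrapT => N; apply: nA.
exists (eta @` A); split.
- by move=> _ [x _ <-]; exists x.
- move=> fA; apply: N.
  (* [xget 0] picks one point of [A] in each class; finitely many classes then have bounded
     representatives. *)
  have : finite_set [set xget 0 [set x | A x /\ eta x = C] | C in eta @` A].
    exact: finite_image.
  move=> /finite_seqP[l El]; exists (\max_(i <- l) i).+1 => x Ax.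
  have [[Aw Ew] wl] : [set x' | A x' /\ eta x' = eta x] (xget 0 [set x' | A x' /\ eta x' = eta x])
      /\ xget 0 [set x' | A x' /\ eta x' = eta x] \in l.
    split; first by apply: (xgetPex 0); exists x.
    have : [set` l] (xget 0 [set x' | A x' /\ eta x' = eta x]).
      by rewrite -El; exists (eta x) => //; exists x.
    by [].
  exists (xget 0 [set x' | A x' /\ eta x' = eta x]); first by rewrite ltnS; exact: seq_leq_bigmax.
  by split=> //; rewrite Ew; exact: er.
rewrite predeqE => y; split=> [Ay|[_ [x Ax <-]]]; last exact: cA.
by exists (eta y); [exists y|exact: er].
Qed.

Lemma eta_infinite_setT eta : positive_equivalence eta -> eta_infinite eta setT.
Proof.
move=> [[er _ _] _ inf]; exists (eta_classes eta); split=> //.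
by rewrite predeqE => x; split=> // _; exists (eta x); [exists x|exact: er].
Qed.

Definition spread (eta : nat -> nat -> Prop) (f : nat -> nat) : Prop :=
  forall n, exists y, forall w, w < n -> ~ eta (f w) (f y).

Lemma eta_infinite_spread eta f : Equivalence eta ->
  eta_infinite eta (range f) -> spread eta f.
Proof.
move=> [er es et] [X [XC infX Ef]] n; apply: contrapT => N; apply: infX.
apply: (@sub_finite_set _ _ ((fun w => eta (f w)) @` `I_n)); last first.
  exact/finite_image/finite_II.
move=> C XC'; have [x _ Ex] := XC _ XC'.
have : range f x by rewrite Ef; exists C => //; rewrite -Ex; exact: er.
move=> [y _ fy]; apply: contrapT => NC; apply: N; exists y => w wn wy.
apply: NC; exists w => //; rewrite -Ex -fy predeqE => z.
by split=> [wz|yz]; [exact: et (es _ _ wy) wz|exact: et wy yz].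
Qed.

(** If the union met finitely many classes, each with a point below [n], then [B i] would be
    determined by its trace [F i] on the points below [n], leaving only finitely many indices in
    [I]. *)
Lemma eta_infinite_bigcup eta (B : nat -> set nat) (I : set nat) : Equivalence eta ->
  injective B -> (forall i x y, B i x -> eta x y -> B i y) ->
  (forall n, exists2 i, n <= i & I i) ->
  eta_infinite eta (fun x => exists i, I i /\ B i x).
Proof.
move=> eqv iB cB infI; apply: contrapT => /(not_eta_infinite _ _ eqv).
case=> [x y [i [Ii Bx]] xy|n Hn]; first by exists i; split=> //; exact: cB Bx xy.
have [er es et] := eqv.
pose F i : {ffun 'I_n -> bool} := [ffun w : 'I_n => `[< B i w >]].
have FI i j : I i -> I j -> F i = F j -> i = j.
  move=> Ii Ij E; apply: iB.
  have sub k l : I k -> F k = F l -> B k `<=` B l.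
    move=> Ik Ekl x Bx; have [w wn [_ wx]] := Hn x (ex_intro _ k (conj Ik Bx)).
    have := congr1 (fun g : {ffun 'I_n -> bool} => g (Ordinal wn)) Ekl; rewrite !ffunE /=.
    rewrite asboolT; last exact: cB Bx (es _ _ wx).
    by move=> /esym/asboolP Bw; exact: cB Bw wx.
  by rewrite predeqE => x; split; apply: sub.
have fI : finite_set I.
  apply: (@sub_finite_set _ _ ((fun v => xget 0 [set i | I i /\ F i = v]) @` setT)).
    move=> i Ii; exists (F i) => //.
    have [Ij /(FI _ _ Ij Ii)] : [set j | I j /\ F j = F i] (xget 0 [set j | I j /\ F j = F i]).
      by apply: (xgetPex 0); exists i.
    by [].
  by apply: finite_image; exact: finite_finset.
have [l El] := (finite_seqP I).1 fI.
have [i li] := infI (\max_(i <- l) i).+1.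
rewrite El /= => il; have : i < i by apply: leq_trans li; rewrite ltnS; exact: seq_leq_bigmax.
by rewrite ltnn.
Qed.

(** By [key], the telltale of N lies in some [B i] other than N, which contradicts the telltale
    property. *)
Lemma setT_not_bc_learnable W eta C : positive_equivalence eta ->
  (forall A, re A -> eta_infinite eta A -> A = setT) ->
  eta_family eta C -> C setT -> ~ bc_learnable W eta C.
Proof.
move=> [eqv _ _] onlyT [_ cC [B [rB iB CB]]] CT /bc_telltale /(_ CT)[D _ HD].
have cB i x y : B i x -> eta x y -> B i y.
  by move: x y; apply/eta_closedP => //; apply: cC; rewrite CB; exists i.
have [i0 _ Bi0] : range B setT by rewrite -CB.
(* Induction on [E]. If only finitely many [i] in [I] have [d] in [B i], the union of the remaining
   [B i] is an eta-infinite r.e. set without [d], contrary to [onlyT]. *)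
have key (E : seq nat) (I : set nat) : re I -> (forall n, exists2 i, n <= i & I i) ->
    exists2 i, I i & forall d, d \in E -> B i d.
  elim: E I => [|d E IH] I rI infI; first by have [i _ Ii] := infI 0; exists i.
  have [infd|] := EM (forall n, exists2 i, n <= i & I i /\ B i d).
    have rId : re (fun i => I i /\ B i d) by retac.
    have [i IBi Hi] := IH _ rId infd; have [Ii Bd] : I i /\ B i d := IBi.
    by exists i => // x; rewrite inE => /orP[/eqP ->|/Hi].
  move=> N; have [n Hn] : exists n, ~ exists2 i, n <= i & I i /\ B i d.
    by apply: contrapT => N'; apply: N => n; apply: contrapT => H; apply: N'; exists n.
  have : (fun x => exists i, (n <= i /\ I i) /\ B i x) = setT.
    apply: onlyT; first by retac.
    apply: (eta_infinite_bigcup eta B (fun i => n <= i /\ I i)) => // m.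
    have [i] := infI (maxn n m); rewrite geq_max => /andP[ni mi] Ii.
    by exists i.
  rewrite predeqE => /(_ d)[_ /(_ Logic.I)[i [[ni Ii] Bd]]].
  by case: Hn; exists i.
have [||i ii0 Hi] := key D (fun i => ~~ (i == i0)).
- by retac.
- move=> n; exists (maxn n i0.+1); first exact: leq_maxl.
  by apply/eqP => E; have := leq_maxr n i0.+1; rewrite E ltnn.
have : B i = setT by apply: HD => //; rewrite CB; exists i.
by rewrite -Bi0 => /iB /eqP; rewrite (negbTE ii0).
Qed.

(** * The chain of a recursive function *)

Definition least_rep (eta : nat -> nat -> Prop) (f : nat -> nat) (w : nat) : Prop :=
  forall v, v < w -> ~ eta (f v) (f w).

(* The number of classes met by [f 0], ..., [f (y - 1)]. *)
Definition rank eta f (y : nat) : nat :=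
  count (fun w => `[< least_rep eta f w >]) (iota 0 y).

(* The union of the first [k + 1] classes met by [f]. *)
Definition chain eta f (k : nat) : set nat :=
  fun x => exists y, eta x (f y) /\ rank eta f y <= k.

Section Chain.
Variables (eta : nat -> nat -> Prop) (f : nat -> nat).
Hypothesis eqv : Equivalence eta.

Lemma rank_S y : rank eta f y.+1 = rank eta f y + `[< least_rep eta f y >].
Proof. by rewrite /rank iota0S count_cat /= addn0. Qed.

Lemma rank_mono y z : y <= z -> rank eta f y <= rank eta f z.
Proof.
move=> /subnK <-; elim: (z - y) => // n IH.
by rewrite addSn rank_S; exact: leq_trans IH (leq_addr _ _).
Qed.

Lemma rank_le y : rank eta f y <= y.
Proof. by rewrite -{2}(size_iota 0 y) count_size. Qed.

Lemma chain_closed k x y : chain eta f k x -> eta x y -> chain eta f k y.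
Proof.
have [er es et] := eqv; move=> [z [xz zk]] xy; exists z; split=> //.
exact: et (es _ _ xy) xz.
Qed.

Lemma chain_rank k y : rank eta f y <= k -> chain eta f k (f y).
Proof. by have [er _ _] := eqv => yk; exists y; split=> //; exact: er. Qed.

(** The index [y] is the first to meet its class, so any [w] witnessing [f y] in the chain has
    [y <= w]. *)
Lemma chain_least_rep k y z : least_rep eta f y -> z <= y ->
  chain eta f k (f y) -> rank eta f z <= k.
Proof.
have [er es et] := eqv; move=> my zy [w [yw wk]]; apply: leq_trans wk.
apply: rank_mono; apply: leq_trans zy _.
by rewrite leqNgt; apply/negP => /my; apply; exact: es.
Qed.

Hypothesis spr : spread eta f.

Lemma rank_unbounded k : exists y, k <= rank eta f y.
Proof.
have [er es et] := eqv; elim: k => [|k [y ky]]; first by exists 0.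
have [z Hz] := spr y.
have ex : exists w, `[< eta (f w) (f z) >] by exists z; apply/asboolP; exact: er.
(* The first index [w] of the class of [f z] is a least representative at or beyond [y], so the rank
   grows there. *)
case: (ex_minnP ex) => w /asboolP wz wmin.
exists w.+1; rewrite rank_S asboolT.
  rewrite addn1 ltnS; apply: leq_trans ky (rank_mono _ _ _).
  by rewrite leqNgt; apply/negP => /Hz.
move=> v vw Evw; have : w <= v by apply: wmin; apply/asboolP; exact: et Evw wz.
by rewrite leqNgt vw.
Qed.

Lemma exists_least_rep k : exists2 y, least_rep eta f y & rank eta f y = k.
Proof.
have ex := rank_unbounded k.+1.
case: (ex_minnP ex) => -[|y] ky ymin; first by move: (leq_trans ky (rank_le 0)).
have yk : rank eta f y <= k.
  by rewrite leqNgt; apply/negP => /ymin; rewrite ltnn.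
move: ky; rewrite rank_S; case: asboolP => [my|_]; last first.
  by rewrite addn0 ltnNge yk.
by rewrite addn1 ltnS => ky; exists y => //; apply/eqP; rewrite eqn_leq yk.
Qed.

(** A witness [z] with [rank eta f z <= k] lies below the first gap [e]: by monotonicity of the
    rank, [e <= z] would put [f e] into the chain. Hence the values before the gap generate the
    member. *)
Lemma chain_least_gap k :
  exists e, [/\ ~ chain eta f k (f e), forall w, w < e -> chain eta f k (f w)
    & chain eta f k = eta_closure eta [set f w | w in `I_e]].
Proof.
have [er es et] := eqv; have [y my ry] := exists_least_rep k.+1.
have ex : exists e, ~~ `[< chain eta f k (f e) >].
  exists y; apply/asboolPn => /(chain_least_rep _ _ _ my (leqnn y)).
  by rewrite ry ltnn.
case: (ex_minnP ex) => e /asboolPn Ne emin.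
have low w : w < e -> chain eta f k (f w).
  move=> we; apply: contrapT => Nw.
  by have := emin w (introN (asboolP _) Nw); rewrite leqNgt we.
exists e; split=> //; rewrite predeqE => x; split=> [[z [xz zk]]|[_ [w we <-]]].
  exists (f z); last exact: es.
  exists z => //=; rewrite ltnNge; apply/negP => /rank_mono ez.
  by apply: Ne; apply: chain_rank; exact: leq_trans ez zk.
exact: chain_closed (low w we).
Qed.

Lemma chain_inj : injective (chain eta f).
Proof.
have lt i j : i < j -> chain eta f i <> chain eta f j.
  move=> ij E; have [y my ry] := exists_least_rep j.
  have : chain eta f i (f y) by rewrite E; apply: chain_rank; rewrite ry.
  by move/(chain_least_rep _ _ _ my (leqnn y)); rewrite ry leqNgt ij.
by move=> i j E; case: (ltngtP i j) => // /lt; rewrite E.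
Qed.

Lemma chain_sub_range k : (forall x y, range f x -> eta x y -> range f y) ->
  chain eta f k `<=` range f.
Proof.
have [_ es _] := eqv.
by move=> cf x [y [/es yx _]]; apply: cf yx; exists y.
Qed.

Lemma chain_absorbs (D : seq nat) : (forall x, x \in D -> range f x) ->
  exists k, forall x, x \in D -> chain eta f k x.
Proof.
elim: D => [|d D IH] HD; first by exists 0.
have [k Hk] := IH (fun x xD => HD x (mem_behead (s := d :: D) xD)).
have [y _ <-] := HD d (mem_head _ _).
(* Since [rank eta f y <= y], the member of index [y] already contains [f y]. *)
exists (maxn k y) => x; rewrite inE => /orP[/eqP ->|/Hk[z [xz zk]]].
  by apply: chain_rank; apply: leq_trans (rank_le y) (leq_maxr _ _).
by exists z; split=> //; exact: leq_trans zk (leq_maxl _ _).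
Qed.

Lemma chain_proper k : chain eta f k <> range f.
Proof.
move=> E; have [e [Ne _ _]] := chain_least_gap k.
by apply: Ne; rewrite E; exists e.
Qed.

End Chain.

(* A true least representative is never refuted, and each of the finitely many
   other indices below [y] is refuted at some stage [t]; so [rank y <= k] as
   soon as at most [k] indices below [y] are unrefuted at some stage. *)
Lemma chain_re eta f : re (fun w => eta (nfst w) (nsnd w)) -> recursive f ->
  uniformly_re (chain eta f).
Proof.
move=> reta rf; have /reP[R rR etaR] := reta.
pose alive t w := ~~ has (fun v => has (fun s =>
  R (npair (npair (f v) (f w)) s)) (iota 0 t)) (iota 0 w).
have etaRP x y : eta x y <-> exists t, R (npair (npair x y) t).
  by rewrite -etaR nfstK nsndK.
have least_alive w t : least_rep eta f w -> alive t w.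
  move=> mw; apply/hasPn => v; rewrite mem_iota add0n /= => vw.
  by apply/hasPn => s _; apply/negP => Rs; apply: (mw v vw); apply/etaRP; exists s.
have rank_alive y k : rank eta f y <= k <-> exists t, count (alive t) (iota 0 y) <= k.
  split=> [yk|[t tk]]; last first.
    by apply: leq_trans tk; apply: sub_count => w /asboolP; exact: least_alive.
  (* Each false candidate below [y] is refuted at a finite stage; past the last of these only true
     least representatives are alive. *)
  have [t Ht] : eventually (fun t => forall w, w < y -> alive t w -> least_rep eta f w).
    apply: (eventually_below (fun w t => alive t w -> least_rep eta f w)) => w _.
    have [mw|] := EM (least_rep eta f w); first by exists 0.
    move=> Nmw; have [v [vw /etaRP[s Rs]]] : exists v, v < w /\ eta (f v) (f w).
      apply: contrapT => N; apply: Nmw => v vw Ev; apply: N; by exists v.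
    exists s.+1 => t st /hasPn/(_ v); rewrite mem_iota add0n => /(_ vw) /hasPn/(_ s).
    by rewrite mem_iota add0n Rs => /(_ st).
  exists t; apply: leq_trans yk; rewrite /rank -!size_filter.
  rewrite (@eq_in_filter _ (alive t) (fun w => `[< least_rep eta f w >])) // => w.
  rewrite mem_iota add0n /= => wy; apply/idP/asboolP; first exact: Ht.
  exact: least_alive.
rewrite uniformly_reP /chain.
have -> : (fun w => exists y, eta (nsnd w) (f y) /\ rank eta f y <= nfst w) =
  (fun w => exists y, eta (nsnd w) (f y) /\
     exists t, count (fun v => alive t v) (iota 0 y) <= nfst w).
  by apply/funext => w; apply/propext; split=> -[y [wy /rank_alive yk]]; exists y.
by rewrite /alive; retac.
Qed.

(** Codes grow at the front, so step [k] of the iteration prepends the entry of index [n - k.+1]. *)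
Lemma recursive_code_append s (h : nat -> nat -> nat) :
  recursive (fun w => h (nfst w) (nsnd w)) ->
  recursive (fun w => code_seq (s ++ mkseq (fun n => Some (h (nfst w) n)) (nsnd w))).
Proof.
move=> rh; elim: s => [|a s IH] /=; last by rec.
have H : recursive (fun w => iteri (nsnd w)
   (fun k r => (npair (h (nfst w) (nsnd w - k.+1)).+1 r).+1) 0).
  rec; apply: (recursive_ext (recursive_comp rh (recursive_pair
     (recursive_nfst _ (recursive_nfst _ recursive_id))
     (recursive_sub _ _ (recursive_nsnd _ (recursive_nfst _ recursive_id))
        (recursive_S _ (recursive_nfst _ (recursive_nsnd _ recursive_id))))))) => w.
  by rewrite nfstK nsndK.
apply: (recursive_ext H) => w; move: (nfst w) (nsnd w) => x n.
have K m : m <= n -> iteri m (fun k r => (npair (h x (n - k.+1)).+1 r).+1) 0 =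
    code_seq [seq Some (h x i) | i <- iota (n - m) m].
  elim: m => // m IH mn; rewrite /= IH ?(ltnW mn) //.
  by rewrite subnSK.
by rewrite K // subnn.
Qed.

Lemma uniformly_re_bool (V : nat -> nat -> bool) :
  recursive (fun w => V (nfst w) (nsnd w) : nat) ->
  uniformly_re (fun e x => V e x : Prop).
Proof. exact: (re_bool (fun w => V (nfst w) (nsnd w))). Qed.

Lemma recursive_mem (l : seq nat) f : recursive f ->
  recursive (fun z => f z \in l : nat).
Proof.
move=> rf; elim: l => [|x l IH]; first exact: (recursive_const 0).
have H : recursive (fun z => (f z == x) || (f z \in l) : nat) by rec.
by apply: (recursive_ext H) => z; rewrite inE.
Qed.

Lemma chain_ex_learnable W eta f : acceptable W -> Equivalence eta ->
  recursive f -> spread eta f -> ex_learnable W eta (range (chain eta f)).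
Proof.
move=> accW eqv rf spr.
(* Candidate [e] is the closure of the first [e] values of [f], rejected once [f e] appears; the
   least survivor is the first gap. *)
apply: (ex_learnable_least W eta (fun e x => has (fun w => f w == x) (iota 0 e))
          (fun c e => seen c (f e))) => //.
- by apply: (uniformly_re_bool (fun e x => has (fun w => f w == x) (iota 0 e))); rec.
- by apply: recursive_seen; rec.
move=> _ T [k _ <-] TL; have [e [Ne low Ek]] := chain_least_gap _ _ eqv spr k.
exists e; split.
- rewrite Ek; congr eta_closure; rewrite predeqE => x; split=> [/hasP[w]|[w we <-]].
    by rewrite mem_iota add0n => we /eqP <-; exists w.
  by apply/hasP; exists w; rewrite // mem_iota add0n.
- by exists 0 => n _; exact: never_seen TL Ne.
by move=> w /low; exact: eventually_seen.
Qed.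

(** * A proper eta-infinite r.e. set *)

Section ProperInfinite.
Variables (W : nat -> set nat) (eta : nat -> nat -> Prop) (f : nat -> nat) (a : nat).
Hypotheses (accW : acceptable W) (eqv : Equivalence eta).
Hypothesis reta : re (fun w => eta (nfst w) (nsnd w)).
Hypotheses (rf : recursive f) (spr : spread eta f).
Hypothesis cf : forall x y, range f x -> eta x y -> range f y.
Hypothesis fa : ~ range f a.

Definition augmented_chain (i : nat) : set nat := fun x =>
  (i == 0 /\ exists w, f w = x) \/ (0 < i /\ (eta a x \/ chain eta f i.-1 x)).

Lemma augmented_chain0 : augmented_chain 0 = range f.
Proof.
rewrite predeqE => x; split=> [[[_ [w <-]]|[]//]|[w _ <-]]; first by exists w.
by left; split=> //; exists w.
Qed.

Lemma augmented_chainS i x :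
  augmented_chain i.+1 x <-> eta a x \/ chain eta f i x.
Proof. by split=> [[[]|[]]|] //; right. Qed.

Lemma chain_avoids k x : chain eta f k x -> ~ eta a x.
Proof.
have [_ es _] := eqv.
by move=> /(chain_sub_range _ _ eqv _ cf) fx /es xa; apply: fa; exact: cf xa.
Qed.

Lemma augmented_chainS_a i : augmented_chain i.+1 a.
Proof. by have [er _ _] := eqv; apply/augmented_chainS; left. Qed.

Lemma augmented_chain_family : eta_family eta (range augmented_chain).
Proof.
have [er es et] := eqv; apply: eta_family_range => //.
- have := chain_re _ _ reta rf; rewrite !uniformly_reP => rC.
  by rewrite /augmented_chain; retac.
- move=> [|i] [|j] //.
  + by rewrite augmented_chain0 => E; case: fa; rewrite E; exact: augmented_chainS_a.
  + by rewrite augmented_chain0 => E; case: fa; rewrite -E; exact: augmented_chainS_a.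
  move=> E; congr S; apply: (chain_inj _ _ eqv spr).
  have sub k l : augmented_chain k.+1 = augmented_chain l.+1 ->
      chain eta f k `<=` chain eta f l.
    move=> Ekl x Cx; have : augmented_chain l.+1 x by rewrite -Ekl augmented_chainS; right.
    by rewrite augmented_chainS => -[/(chain_avoids _ _ Cx)|].
  by rewrite predeqE => x; split; apply: sub.
- move=> [|i] x y; first by rewrite augmented_chain0; exact: cf.
  rewrite !augmented_chainS => -[ax|Cx] xy; first by left; exact: et ax xy.
  by right; exact: chain_closed eqv _ _ _ Cx xy.
Qed.

(** Seeing [a] separates [range f], candidate 0, from the other members; for these, candidate [e.+1]
    is rejected once [f e] appears, as in the plain chain. *)
Lemma augmented_chain_ex_learnable : ex_learnable W eta (range augmented_chain).
Proof.
have [er es et] := eqv.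
pose V e x := (e == 0 /\ exists w, f w = x) \/
  (0 < e /\ (a = x \/ exists w, w < e.-1 /\ f w = x)).
apply: (ex_learnable_least W eta V
  (fun c e => ((e == 0) && seen c a) || ((0 < e) && seen c (f e.-1)))) => //.
- by rewrite uniformly_reP /V; retac.
- by rec; apply: recursive_seen; rec.
move=> _ T [[|k] _ <-] TL.
  exists 0; split=> //.
    rewrite augmented_chain0 predeqE => y; split=> [[x [[_ [w <-]]|[]//]]|[w _ <-]].
      by apply: cf; exists w.
    by exists (f w); [left; split=> //; exists w|exact: er].
  exists 0 => n _; rewrite orbF /=; apply: never_seen TL _.
  by rewrite augmented_chain0.
have [e [Ne low Ek]] := chain_least_gap _ _ eqv spr k.
exists e.+1; split.
- rewrite predeqE => y; rewrite augmented_chainS Ek.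
  split=> [[x [[]//|[_ [<-|[w [we <-]]]]]]|[ay|[_ [w we <-] wy]]].
  + by left.
  + by right; exists (f w) => //; exists w.
  + by exists a => //; right; split=> //; left.
  + by exists (f w) => //; right; split=> //; right; exists w.
- exists 0 => n _ /=; apply: never_seen TL _; rewrite augmented_chainS => -[ae|//].
  by apply: fa; apply: (cf (f e)); [exists e|exact: es].
move=> [_|w].
  by apply: eventually_mono (eventually_seen _ _ _ TL (augmented_chainS_a k)) => n /= ->.
rewrite ltnS => /low Cw /=; apply: eventually_seen TL _.
by rewrite augmented_chainS; right.
Qed.

Lemma chain_augmented_disjoint : range (chain eta f) `&` range augmented_chain = set0.
Proof.
have [er _ _] := eqv.
rewrite predeqE => L; split=> // -[[k _ <-] [[|i] _]].
  by rewrite augmented_chain0 => /esym; exact: chain_proper.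
move=> E; have : chain eta f k a by rewrite -E; exact: augmented_chainS_a.
by move=> /chain_avoids; apply; exact: er.
Qed.

(** Every finite telltale for [range f] is absorbed by a member of the chain, a proper subset of
    [range f] in the same union. *)
Lemma chain_augmented_not_bc :
  ~ bc_learnable W eta (range (chain eta f) `|` range augmented_chain).
Proof.
move=> /(bc_telltale _ _ _ (range f)) [|D Df HD].
  by right; exists 0 => //; exact: augmented_chain0.
have [k Dk] := chain_absorbs _ _ eqv D Df.
apply: (chain_proper _ _ eqv spr k); apply: HD => //; first by left; exists k.
exact: chain_sub_range.
Qed.

End ProperInfinite.

(** * No proper eta-infinite r.e. set *)

Section OnlyInfinite.
Variables (W : nat -> set nat) (eta : nat -> nat -> Prop) (b : nat).
Hypotheses (accW : acceptable W) (eqv : Equivalence eta).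
Hypothesis reta : re (fun w => eta (nfst w) (nsnd w)).
Hypothesis spr : spread eta id.
Hypothesis zb : ~ eta 0 b.

(* With [x = b + i + 1]: the union of the classes of [0] and [x] for as long as
   [x] looks like the least element of its class; once it does not, the set
   turns into a member of the chain, chosen so that no set is repeated. *)
Definition two_classes (i : nat) : set nat := fun y =>
  eta 0 y \/ (eta (b + i.+1) y \/
    ((exists z, z < b + i.+1 /\ eta z (b + i.+1)) /\
     chain eta id (b + i.+1).*2.+1 y)).

Lemma two_classes_least i y : least_rep eta id (b + i.+1) ->
  two_classes i y <-> eta 0 y \/ eta (b + i.+1) y.
Proof.
move=> m; split=> [[|[|[[z [zx Ez]] _]]]|[|]].
- by left.
- by right.
- by case: (m z zx).
- by left.
- by right; left.
Qed.

(** The rank of [x = b + i.+1] is at most [x], so the chain member of index [2x + 1] already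
    contains the classes of 0 and [x], and the other disjuncts add nothing. *)
Lemma two_classes_chain i : ~ least_rep eta id (b + i.+1) ->
  two_classes i = chain eta id (b + i.+1).*2.+1.
Proof.
have [er es et] := eqv; move=> Nm; rewrite predeqE => y; split=> [[|[|[]//]]|Cy].
- by apply: chain_closed eqv _ _ _ _; exact: (chain_rank _ id eqv _ 0).
- apply: chain_closed eqv _ _ _ _; apply: (chain_rank _ id eqv).
  by apply: leq_trans (rank_le _ _ _) _; rewrite -addnn -addnS leq_addr.
- right; right; split=> //; apply: contrapT => N; apply: Nm => z zx Ez.
  by apply: N; exists z.
Qed.

(** The point [b] distinguishes the two forms of [two_classes i]: the two-class form omits it, and
    by [chain_b] the chain form contains it. *)
Lemma two_classes_b i : least_rep eta id (b + i.+1) -> ~ two_classes i b.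
Proof.
have [er es et] := eqv.
move=> m; rewrite two_classes_least // => -[//|/es]; apply: (m b).
by rewrite addnS ltnS leq_addr.
Qed.

Lemma chain_b x : b <= x -> chain eta id x.*2.+1 b.
Proof.
move=> bx; apply: (chain_rank _ id eqv); apply: leq_trans (rank_le _ _ _) _.
by apply: leq_trans bx _; rewrite -addnn -addnS leq_addr.
Qed.

Lemma two_classes_inj : injective two_classes.
Proof.
have [er es et] := eqv; move=> i j E.
have bb k : b <= b + k by exact: leq_addr.
have [mi|Nmi] := EM (least_rep eta id (b + i.+1));
have [mj|Nmj] := EM (least_rep eta id (b + j.+1)).
- have : two_classes j (b + i.+1) by rewrite -E two_classes_least //; right; exact: er.
  rewrite two_classes_least // => -[Ei|Ej].
    by case: (mi 0); rewrite // addnS.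
  (* Of two distinct equivalent numbers, the larger is no least representative. *)
  case: (ltngtP (b + i.+1) (b + j.+1)) => [ij|ij|/eqP].
  + by case: (mj _ ij); exact: es.
  + by case: (mi _ ij).
  + by rewrite eqn_add2l eqSS => /eqP.
- by case: (two_classes_b i mi); rewrite E two_classes_chain //; exact: chain_b.
- by case: (two_classes_b j mj); rewrite -E two_classes_chain //; exact: chain_b.
- move: E; rewrite !two_classes_chain // => /(chain_inj _ _ eqv spr)[] /double_inj /eqP.
  by rewrite eqn_add2l eqSS => /eqP.
Qed.

Lemma two_classes_family : eta_family eta (range two_classes).
Proof.
have [er es et] := eqv; apply: eta_family_range => //.
- have := chain_re _ _ reta recursive_id; rewrite !uniformly_reP => rC.
  by rewrite /two_classes; retac.
- exact: two_classes_inj.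
move=> i x y [zx|[ix|[H Cx]]] xy; first by left; exact: et zx xy.
  by right; left; exact: et ix xy.
by right; right; split=> //; exact: chain_closed eqv _ _ _ Cx xy.
Qed.

Lemma two_classes_ex_learnable : ex_learnable W eta (range two_classes).
Proof.
have [er es et] := eqv; have /reP[R rR etaR] := reta.
have etaRP x y : eta x y <-> exists t, R (npair (npair x y) t).
  by rewrite -etaR nfstK nsndK.
(* Even candidates [2x] stand for the classes of 0 and [x], odd candidates [2m + 1] for the closure
   of the numbers below [m]. *)
pose V e x := (~~ odd e && ((x == 0) || (x == e./2))) || (odd e && (x < e./2)).
(* Without [b] in the data, the least [x] that is seen and never found equivalent to 0 wins; with
   [b], the first [m] missing from the data. Rejections based on unseen points may be withdrawn
   later. *)
pose reject c e :=
  (~~ odd e && (seen c b || (~~ seen c e./2 ||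
      has (fun t => R (npair (npair 0 e./2) t)) (iota 0 c)))) ||
  (odd e && (~~ seen c b || seen c e./2)).
apply: (ex_learnable_least W eta (fun e x => V e x) reject) => //.
- by apply: uniformly_re_bool; rewrite /V; rec.
- by rewrite /reject; rec; apply: recursive_seen; rec.
move=> _ T [i _ <-] TL.
have [m|Nm] := EM (least_rep eta id (b + i.+1)).
- have Nb := two_classes_b i m.
  exists (b + i.+1).*2; split.
  + rewrite /V odd_double doubleK /=; rewrite predeqE => y; rewrite two_classes_least //.
    split=> [[x]|[zy|xy]].
    * by rewrite orbF => /orP[/eqP ->|/eqP ->]; [left|right].
    * by exists 0; rewrite //= orbF.
    * by exists (b + i.+1); rewrite //= orbF eqxx orbT.
  + have Lx : two_classes i (b + i.+1) by right; left; exact: er.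
    apply: eventually_mono (eventually_seen _ _ _ TL Lx) => n sx.
    rewrite /reject odd_double doubleK sx (negbTE (never_seen _ _ _ _ TL Nb)) /= orbF.
    apply/hasPn => t _; apply/negP => Rt.
    by apply: (m 0); [rewrite addnS|apply/etaRP; exists t].
  move=> e ex; case: (boolP (odd e)) => oe.
    by exists 0 => n _; rewrite /reject oe (never_seen _ _ _ _ TL Nb).
  have ex2 : e./2 < b + i.+1.
    by move: ex; rewrite -{1}[e]odd_double_half (negbTE oe) add0n ltn_double.
  have [/etaRP[t Rt]|Nz] := EM (eta 0 e./2).
    apply: eventually_mono (eventually_code T t.+1) => n tn.
    rewrite /reject oe /=; apply/orP; left; apply/orP; right; apply/orP; right.
    by apply/hasP; exists t; rewrite // mem_iota.
  exists 0 => n _; rewrite /reject oe /=; apply/orP; left; apply/orP; right.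
  apply/orP; left; apply: never_seen TL _; rewrite two_classes_least // => -[//|/es].
  exact: m.
move: TL; rewrite two_classes_chain // => TL.
have [e [Ne low Ek]] := chain_least_gap _ _ eqv spr (b + i.+1).*2.+1.
have sb := eventually_seen _ _ _ TL (chain_b _ (leq_addr i.+1 b)).
exists e.*2.+1; split.
- rewrite Ek; congr eta_closure; rewrite predeqE => x.
  rewrite /V /= odd_double uphalf_double; split=> [xe|[w we <-] //].
  by exists x.
- apply: eventually_mono sb => n sb.
  by rewrite /reject /= odd_double uphalf_double sb (negbTE (never_seen _ _ _ _ TL Ne)).
move=> k ke; case: (boolP (odd k)) => ok; last first.
  by apply: eventually_mono sb => n sb; rewrite /reject ok sb.
have k2 : k./2 < e.
  by move: ke; rewrite -{1}[k]odd_double_half ok ltnS add1n ltn_double.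
apply: eventually_mono (eventually_seen _ _ _ TL (low _ k2)) => n sk.
by rewrite /reject ok sk orbT orbT.
Qed.

Definition even_chain (k : nat) : set nat := chain eta id k.*2.

Lemma even_chain_family : eta_family eta (range even_chain).
Proof.
apply: eta_family_range => //.
- have := chain_re _ _ reta recursive_id; rewrite !uniformly_reP => rC.
  by rewrite /even_chain; retac.
- by move=> i j /(chain_inj _ _ eqv spr)/double_inj.
by move=> i x y; exact: chain_closed.
Qed.

Lemma even_chain_ex_learnable : ex_learnable W eta (range even_chain).
Proof.
apply: ex_learnable_sub (chain_ex_learnable _ _ _ accW eqv recursive_id spr).
by move=> _ [k _ <-]; exists k.*2.
Qed.

(** If [x = b + i.+1] is a least representative, a chain member containing [x] also contains the
    smaller [b], which [two_classes i] omits. Otherwise the two chain indices differ in parity. *)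
Lemma even_chain_disjoint : range even_chain `&` range two_classes = set0.
Proof.
have [er es et] := eqv.
rewrite predeqE => L; split=> // -[[k _ <-] [i _]] E.
have [m|Nm] := EM (least_rep eta id (b + i.+1)).
  apply: (two_classes_b i m); rewrite E; apply: (chain_rank _ id eqv).
  apply: (chain_least_rep _ id eqv _ _ _ m (leq_addr _ _)).
  by rewrite -[chain _ _ _]E; right; left; exact: er.
move: E; rewrite two_classes_chain // => /(chain_inj _ _ eqv spr) /(congr1 odd).
by rewrite /= !odd_double.
Qed.

Lemma even_chain0 y : even_chain 0 y <-> eta 0 y.
Proof.
have [er es et] := eqv; split=> [[[|z] [yz]]|zy].
- by move=> _; exact: es.
(* Index 0 is always a least representative, so the rank is positive from 1 on. *)
- rewrite leqNgt; case/negP; apply: leq_trans (rank_mono _ _ _ _ (ltn0Sn z)).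
  by rewrite rank_S asboolT // addn1.
by exists 0; split=> //; exact: es.
Qed.

(* On data from the class of [0], past a locking sequence [s], the learner
   outputs indices from a finite list [E] of hypotheses for that class.  On data
   from the classes of [0] and [x] with [x] a large least representative, it must
   leave [E]; so leaving [E] is an r.e. event that separates the class of [0]
   from all but finitely many classes. *)
Lemma even_chain_two_classes_not_vac :
  (forall A, re A -> eta_infinite eta A -> A = setT) ->
  ~ vac_learnable W eta (range even_chain `|` range two_classes).
Proof.
have [er es et] := eqv; have /reP[R rR etaR] := reta.
have etaRP x y : eta x y <-> exists t, R (npair (npair x y) t).
  by rewrite -etaR nfstK nsndK.
move=> onlyT [M [g rg gM] vM].
have [|s [E [As EA sE]]] := vac_locking _ _ _ _ (even_chain 0) vM.
  by left; exists 0.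
(* Entry [n] codes a point and a stage; it lists the point if the stage confirms it equivalent to 0
   or [x], and 0 otherwise. *)
pose h x n := if R (npair (npair 0 (nfst n)) (nsnd n)) ||
  R (npair (npair x (nfst n)) (nsnd n)) then nfst n else 0.
have rh : recursive (fun w => h (nfst w) (nsnd w)).
  by apply: (recursive_if (fun w => R (npair (npair 0 (nfst (nsnd w))) (nsnd (nsnd w))) ||
      R (npair (npair (nfst w) (nfst (nsnd w))) (nsnd (nsnd w))))); rec.
pose tx x : text := fun n => Some (h x n).
have txP x : text_for (tx x) (fun y => eta 0 y \/ eta x y).
  rewrite /text_for predeqE => y; split=> [[/etaRP|/etaRP] [t Rt]|[n [<-]]].
  - by exists (npair y t); rewrite /tx /h !nfstK !nsndK Rt.
  - by exists (npair y t); rewrite /tx /h !nfstK !nsndK Rt orbT.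
  rewrite /h; case: ifP => [/orP[Rn|Rn]|_]; last by left; exact: er.
  - by left; apply/etaRP; exists (nsnd n).
  - by right; apply/etaRP; exists (nsnd n).
pose U x := exists n, g (code_seq (s ++ mkseq (tx x) n)) \notin map code_option E.
have UP x : U x <-> exists n, M (s ++ mkseq (tx x) n) \notin E.
  have ic : injective code_option by move=> [u|] [v|] //= [->].
  by split=> -[n Hn]; exists n; move: Hn; rewrite gM mem_map.
have rU : re U.
  rewrite /U; apply: (re_ex (fun x n => g (code_seq (s ++ mkseq (tx x) n)) \notin map code_option E)).
  apply: (re_bool (fun w => g (code_seq (s ++ mkseq (tx (nfst w)) (nsnd w))) \notin _)).
  apply: (recursive_negb (fun w => g _ \in _)); apply: recursive_mem.
  by apply: (recursive_comp rg); exact: recursive_code_append.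
(* If [x] is equivalent to 0, the text stays in the class of 0, where the outputs are locked into
   [E]. *)
have NU0 x : U x -> ~ eta 0 x.
  move=> /UP[n Mn] zx; move: Mn; rewrite sE // => y /mapP[k _ [->]].
  apply/even_chain0; have : exists m, tx x m = Some (h x k) by exists k.
  have := txP x; rewrite /text_for predeqE => /(_ (h x k))[_ H] /H[//|].
  exact: et.
(* Were [E] never left, a correct hypothesis for [two_classes i] would denote the class of 0, which
   misses [b + i.+1]. *)
have UL i : least_rep eta id (b + i.+1) -> U (b + i.+1).
  move=> m; apply/UP; apply: contrapT => N.
  have TL : text_for (tx (b + i.+1)) (two_classes i).
    have -> : two_classes i = (fun y => eta 0 y \/ eta (b + i.+1) y).
      by rewrite predeqE => y; exact: two_classes_least.
    exact: txP.
  have CL : (range even_chain `|` range two_classes) (two_classes i) by right; exists i.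
  have sT : text_for (append_text s (tx (b + i.+1))) (two_classes i).
    by apply: append_text_for => // y /As /even_chain0; left.
  have [n0 Hn] := vM.1 _ _ CL sT.
  have [e] := Hn _ (leq_addl (size s) n0); rewrite mkseq_append_text => Me We.
  have : M (s ++ mkseq (tx (b + i.+1)) n0) \in E.
    by apply: contrapT => /negP NE; apply: N; exists n0.
  rewrite Me => /EA[e' [<-]]; rewrite We => E0.
  have : two_classes i (b + i.+1) by right; left; exact: er.
  by rewrite E0 even_chain0; apply: (m 0); rewrite addnS.
(* The closure of [U] contains every least representative above [b], so it is eta-infinite and
   equals N; yet by [NU0] it misses 0. *)
pose cU y := exists x, U x /\ eta x y.
have cUT : cU = setT.
  apply: onlyT; first by rewrite /cU; retac.
  apply: contrapT => /(not_eta_infinite _ _ eqv)[|n Hn].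
    by move=> x y [z [Uz zx]] xy; exists z; split=> //; exact: et zx xy.
  (* As [rank eta id y <= y], a large rank forces [y] to be at least [n] and above [b]. *)
  have [y my ry] := exists_least_rep _ _ eqv spr (maxn n b.+1).
  have := rank_le eta id y; rewrite ry geq_max => /andP[ny by_].
  have Uy : U y by move: (UL (y - b.+1)); rewrite addnS -addSn subnKC //; exact.
  have [|w wn [_ wy]] := Hn y; first by exists y; split=> //; exact: er.
  by apply: (my w) wy; exact: leq_trans wn ny.
have : cU 0 by rewrite cUT.
by move=> [x [/NU0 Nx /es]].
Qed.

End OnlyInfinite.

(** * The witnessing families and the two cases of the theorem *)

Lemma proper_eta_infinite_witness W eta A : acceptable W -> positive_equivalence eta ->
  re A -> eta_infinite eta A -> A <> setT ->
  exists L1 L2, [/\ eta_family eta L1 /\ ex_learnable W eta L1,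
    eta_family eta L2 /\ ex_learnable W eta L2, L1 `&` L2 = set0,
    eta_family eta (L1 `|` L2) & ~ bc_learnable W eta (L1 `|` L2)].
Proof.
move=> accW [eqv reta _] rA iA AT.
have cA x y : A x -> eta x y -> A y.
  move: x y; apply/eta_closedP => //; have [X [XC _ ->]] := iA.
  by exists X.
have [a Na] : exists a, ~ A a.
  apply: contrapT => N; apply: AT; rewrite predeqE => x; split=> // _.
  by apply: contrapT => Nx; apply: N; exists x.
case: rA => [A0|[f rf Af]].
  have [er _ _] := eqv; have [X [XC infX EA]] := iA.
  case: infX; have -> : X = set0; last exact: finite_set0.
  rewrite predeqE => C; split=> // XC'; have [x _ Ex] := XC _ XC'.
  have : A x by rewrite EA; exists C => //; rewrite -Ex; exact: er.
  by rewrite A0.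
rewrite {}Af in iA cA Na.
have spr := eta_infinite_spread _ _ eqv iA.
have f1 : eta_family eta (range (chain eta f)).
  apply: eta_family_range => //; [exact: chain_re|exact: chain_inj|].
  by move=> i x y; exact: chain_closed.
have f2 := augmented_chain_family _ _ _ eqv reta rf spr cA Na.
have dis := chain_augmented_disjoint _ _ _ eqv spr cA Na.
exists (range (chain eta f)), (range (augmented_chain eta f a)); split=> //.
- by split=> //; exact: chain_ex_learnable.
- by split=> //; exact: augmented_chain_ex_learnable.
- exact: eta_family_union.
- exact: chain_augmented_not_bc.
Qed.

Lemma only_eta_infinite_witness W eta : acceptable W -> positive_equivalence eta ->
  (forall A, re A -> eta_infinite eta A -> A = setT) ->
  exists L1 L2, [/\ eta_family eta L1 /\ ex_learnable W eta L1,
    eta_family eta L2 /\ ex_learnable W eta L2, L1 `&` L2 = set0,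
    eta_family eta (L1 `|` L2) & ~ vac_learnable W eta (L1 `|` L2)].
Proof.
move=> accW pos onlyT; have [eqv reta _] := pos.
have spr : spread eta id.
  by apply: eta_infinite_spread => //; rewrite image_id; exact: eta_infinite_setT.
have [b Hb] := spr 1; have zb : ~ eta 0 b by exact: Hb.
have f1 := even_chain_family _ eqv reta spr.
have f2 := two_classes_family _ _ eqv reta spr zb.
have dis := even_chain_disjoint _ _ eqv spr zb.
exists (range (even_chain eta)), (range (two_classes eta b)); split=> //.
- by split=> //; exact: even_chain_ex_learnable.
- by split=> //; exact: two_classes_ex_learnable.
- exact: eta_family_union.
- exact: even_chain_two_classes_not_vac.
Qed.

(** Members of the union are r.e.; an eta-infinite one would be N, which belongs to neither family
    by [setT_not_bc_learnable]. So [bc_learnable_content] applies. *)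
Lemma bc_closed_under_union W eta : acceptable W -> positive_equivalence eta ->
  (forall A, re A -> eta_infinite eta A -> A = setT) ->
  closed_under_union eta (bc_learnable W eta).
Proof.
move=> accW pos onlyT; have [eqv reta _] := pos.
move=> C C' fC fC' bC bC' [_ cCC [B [rB iB CB]]].
apply: bc_learnable_content => // L CL.
have cL x y : L x -> eta x y -> L y.
  by move: x y; apply/eta_closedP => //; exact: cCC.
split=> //; apply: not_eta_infinite => // iL.
have LT : L = setT.
  apply: onlyT iL; move: CL; rewrite CB => -[i _ <-].
  by move: rB; rewrite uniformly_reP => rB'; apply: (re_comp2 B (fun=> i) id rB'); rec.
case: CL; rewrite LT => CT.
  exact: (setT_not_bc_learnable _ _ _ pos onlyT fC CT bC).
exact: (setT_not_bc_learnable _ _ _ pos onlyT fC' CT bC').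
Qed.

Theorem theorem6 (W : nat -> set nat) (hW : acceptable W)
    (eta : nat -> nat -> Prop) (heta : positive_equivalence eta) :
  ((exists L1 L2 : set (set nat),
      [/\ eta_family eta L1 /\ ex_learnable W eta L1,
          eta_family eta L2 /\ ex_learnable W eta L2,
          L1 `&` L2 = set0,
          eta_family eta (L1 `|` L2)
        & ~ ex_learnable W eta (L1 `|` L2)]) /\
   (exists L1 L2 : set (set nat),
      [/\ eta_family eta L1 /\ vac_learnable W eta L1,
          eta_family eta L2 /\ vac_learnable W eta L2,
          L1 `&` L2 = set0,
          eta_family eta (L1 `|` L2)
        & ~ vac_learnable W eta (L1 `|` L2)])) /\
  (closed_under_union eta (bc_learnable W eta) <->
   forall A : set nat, (re A /\ eta_infinite eta A) <-> A = [set: nat]).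
Proof.
(* In either case one pair of explanatorily learnable families serves both halves of (a): its union
   fails vacillatory learning in the first case and even behaviourally correct learning in the
   second. *)
have [onlyT|N] := EM (forall A, re A -> eta_infinite eta A -> A = setT).
  have [L1 [L2 [[f1 e1] [f2 e2] dis f12 Nvac]]] := only_eta_infinite_witness _ _ hW heta onlyT.
  split; last first.
    split=> _; last exact: bc_closed_under_union.
    move=> A; split=> [[]|->]; first exact: onlyT.
    split; last exact: eta_infinite_setT.
    by right; exists id; [exact: recursive_id|rewrite image_id].
  split; exists L1, L2; split=> //.
  - by move=> /ex_learnable_vac.
  - by split=> //; exact: ex_learnable_vac.
  - by split=> //; exact: ex_learnable_vac.
have [A [rA [iA AT]]] : exists A, re A /\ eta_infinite eta A /\ A <> setT.
  apply: contrapT => N'; apply: N => A rA iA; apply: contrapT => AT.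
  by apply: N'; exists A.
have [L1 [L2 [[f1 e1] [f2 e2] dis f12 Nbc]]] :=
  proper_eta_infinite_witness _ _ _ hW heta rA iA AT.
split; last first.
  split=> H.
    (* The same pair refutes closure under union for behaviourally correct learning. *)
    case: Nbc; apply: H => //; exact/vac_learnable_bc/ex_learnable_vac.
  by case: AT; apply/H.
split; exists L1, L2; split=> //.
- by move=> /ex_learnable_vac/vac_learnable_bc.
- by split=> //; exact: ex_learnable_vac.
- by split=> //; exact: ex_learnable_vac.
- by move=> /vac_learnable_bc.
Qed.
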